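(* Let $G$ be a trivalent graph with a perfect matching $M$, and let $\Gamma_M$ be a perfect matching graph for the pair $(G,M)$, represented by a ribbon diagram in the plane whose virtual crossings involve only edges of $G\setminus M$. Then for every positive integer $n$, $\left\llbracket \Gamma_M\right\rrbracket=\{G,M\}$.
   Context: Graphs are finite multigraphs. A ribbon graph of $G$ is an embedding of $G$ into a compact surface with boundary that deformation retracts onto the image of $G$; a perfect matching graph $\Gamma_M$ is a ribbon graph of $G$ with a perfect matching $M=\{e_1,\dots,e_\ell\}$. A ribbon diagram is a drawing of it in the plane respecting the cyclic order of edges at each vertex; edge crossings in the drawing are virtual crossings; let $X$ be the set of virtual crossings. Smoothings: for a matching edge $e=uv$ with other edge-ends $a,b$ at $u$ and $c,d$ at $v$, $a$ and $c$ on the same side of $e$, the $0$-smoothing deletes $e,u,v$ and joins $a$–$c$ and $b$–$d$ by two parallel arcs; the $1$-smoothing joins $a$–$d$ and $b$–$c$ by two arcs crossing once (an ordinary crossing). For $\alpha\in\{0,1\}^\ell$ the state $\Gamma_\alpha$ is the resulting collection of closed immersed curves, $|\alpha|=\sum\alpha_i$; each matching edge gives a pair of arcs of $\Gamma_\alpha$. Penrose–Kauffman bracket: $$\left\llbracket \Gamma_M\right\rrbracket=\sum_{\alpha\in\{0,1\}^\ell}\ \sum_{\beta:X\to\{\mathrm{node},\mathrm{cross}\}}(-1)^{|\alpha|}\,2^{\#\beta^{-1}(\mathrm{node})}\,(-1)^{\#\beta^{-1}(\mathrm{cross})}\,n^{c(\alpha,\beta)},$$ where $c(\alpha,\beta)$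 is the number of connected components of the space obtained from the disjoint union of the curves of $\Gamma_\alpha$ by gluing together the two strands at each virtual crossing $x$ with $\beta(x)=\mathrm{node}$ (strands at ''cross'' crossings just pass through). Equivalently it is defined recursively by: matching edge $=$ $0$-smoothing $-$ $1$-smoothing; virtual crossing $=2\cdot$(node, the two strands treated as part of one circle) $-$ (ordinary crossing); each closed curve, with curves joined at nodes counting as one, has value $n$. Color bracket: $\{G,M\}=\sum_{\alpha}N(\Gamma_\alpha)$, where $N(\Gamma_\alpha)$ is the number of assignments of colors from $\{1,\dots,n\}$ to the curves of $\Gamma_\alpha$ such that, for each matching edge, the two arcs produced by smoothing it lie on curves of different colors. This equals the number of perfect matching $n$-colorings of $(G,M)$: colorings of the non-matching edges with colors from $\{1,\dots,n\}$ such that exactly two distinct colors are used on the edges adjacent to each matching edge and both colors appear at each end of the matching edge. *)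

(* Defs.v *)
(* Combinatorial-map encoding of a planar ribbon diagram of a
   trivalent graph with a perfect matching, virtual crossings being 4-valent
   vertices of the map. *)
From mathcomp Require Import all_boot all_order all_algebra.
Set Implicit Arguments. Unset Strict Implicit. Unset Printing Implicit Defensive.
Import GRing.Theory Num.Theory.
Local Open Scope ring_scope.

Section RibbonDiagram.
Variables (D : finType) (al sg : D -> D) (mt : D -> bool).
(* D  : darts (half-edges) of the planar drawing, where each virtual crossing
        is an extra 4-valent vertex subdividing the (non-matching) edges;
   al : the edge involution (the other end of the edge segment);
   sg : the rotation (cyclic order of darts around a vertex, in the plane);
   mt : dart belongs to a matching edge. *)

Definition is_map : Prop :=
  (forall d, al (al d) = d) /\ (forall d, al d != d) /\ injective sg.

Definition map_vertices : nat := fcard sg D.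
Definition map_edges : nat := (#|D| %/ 2)%N.
Definition map_faces : nat := fcard (sg \o al) D.
Definition map_conn (x y : D) : bool := (y == sg x) || (x == sg y) || (y == al x).
Definition map_components : nat := n_comp map_conn D.

(* genus 0 on every component: the map is a drawing in the plane *)
Definition planar_map : Prop :=
  (map_vertices + map_faces = map_edges + 2 * map_components)%N.

(* walking along a strand straight through a crossing *)
Definition strand_step (d : D) : D := sg (sg (al d)).

(* vertices of G are the 3-valent vertices, virtual crossings the 4-valent ones;
   exactly one matching dart at each vertex of G; no matching dart at a
   crossing; every strand through crossings ends at vertices of G. *)
Definition trivalent_pm_diagram : Prop :=
  [/\ is_map, planar_map,
      (forall d, order sg d = 3%N \/ order sg d = 4%N),
      (forall d, mt (al d) = mt d) &
      [/\ (forall d, order sg d = 3%N -> (mt d + mt (sg d) + mt (sg (sg d)) = 1)%N),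
          (forall d, order sg d = 4%N -> mt d = false) &
          (forall d, exists k, order sg (al (iter k strand_step d)) = 3%N)]].

Definition matching_edges : {set D} := [set d | mt d && froots al d].
Definition crossings : {set D} := [set d | (order sg d == 4%N) && froots sg d].

(* a state alpha is the set of matching edges receiving the 1-smoothing *)
(* smoothing pairs at the matching edge of dart m: with a = sg m, b = sg^2 m,
   c = sg (al m), d = sg^2 (al m), the pairs on the same side of the edge are
   (a,d) and (b,c); 0-smoothing joins a-d, b-c; 1-smoothing joins a-c, b-d *)
Definition smooth_rel (alpha : {set D}) (m x y : D) : bool :=
  mt m &&
  (if froot al m \in alpha then
     ((x == sg m) && (y == sg (al m))) || ((x == sg (sg m)) && (y == sg (sg (al m))))
   else
     ((x == sg m) && (y == sg (sg (al m)))) || ((x == sg (sg m)) && (y == sg (al m)))).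

(* beta = set of crossings resolved as "node" (the two strands glued) *)
Definition state_rel0 (alpha beta : {set D}) (x y : D) : bool :=
  ~~ mt x && ~~ mt y &&
  [|| y == al x,
      (order sg x == 4%N) && (y == sg (sg x)),
      (order sg x == 4%N) && (froot sg x \in beta) && (y == sg x)
    | [exists m, smooth_rel alpha m x y]].

Definition state_rel (alpha beta : {set D}) (x y : D) : bool :=
  state_rel0 alpha beta x y || state_rel0 alpha beta y x.

Definition ncomp_state (alpha beta : {set D}) : nat :=
  n_comp (state_rel alpha beta) [pred d | ~~ mt d].

Definition pk_bracket (n : nat) : int :=
  \sum_(alpha in powerset matching_edges) \sum_(beta in powerset crossings)
    ((-1) ^+ #|alpha| * (2%:Z) ^+ #|beta| * (-1) ^+ (#|crossings| - #|beta|)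
       * (n%:Z) ^+ ncomp_state alpha beta).

(* N(Gamma_alpha): colourings of the curves of Gamma_alpha (functions on darts
   constant along curves; a matching dart copies the colour of its successor
   so that it carries no extra freedom) such that the two arcs of each
   matching edge lie on curves of different colours *)
Definition state_colorings (n : nat) (alpha : {set D}) : nat :=
  #|[set col : {ffun D -> 'I_n} |
      [forall x, forall y, state_rel alpha set0 x y ==> (col x == col y)] &&
      [forall m, mt m ==> (col m == col (sg m)) && (col (sg m) != col (sg (sg m)))]]|.

Definition color_bracket (n : nat) : int :=
  \sum_(alpha in powerset matching_edges) (state_colorings n alpha)%:Z.

End RibbonDiagram.

(* Main.v *)
(** Grouping the expansion of the bracket by colourings of the non-matching
    edges, a crossing contributes [2 - 1 = 1] if its two strands have the same
    colour and [-1] otherwise; a matching edge contributes [1 - 1 = 0] unless its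
    two arcs have different colours.  It remains to see that every colouring
    counted by the colour bracket has sign [+1], i.e. that the crossings, virtual
    or created by a 1-smoothing, between strands of different colours are even in
    number.  For a colour [t], the edges of colour below [t] (a matching edge
    counted with both its colours mod 2) form a mod 2 cycle.  As the map has
    genus 0, a dimension count over F_2 shows that it is the boundary of a set of
    faces, with indicator [f t].  The sum of [f (col x) x] over the non-matching
    darts [x] vanishes when computed edge by edge, and is the number of
    bichromatic crossings mod 2 when computed vertex by vertex. *)
Require Import Defs.
From mathcomp Require Import all_boot all_order all_algebra.
From mathcomp Require Import mxabelem zify.

Set Implicit Arguments.
Unset Strict Implicit.
Unset Printing Implicit Defensive.

Import GRing.Theory Num.Theory.

(** * Functions constant on components, and sums over orbits *)

(** Such a function is freely determined by its values at the component roots in [a]; the clause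
    with [h] fixes the values outside [a]. *)
Lemma card_loc_const (T R : finType) (e : rel T) (a : {pred T}) (h : T -> T) :
    connect_sym e -> closed e a -> (forall x, x \notin a -> h x \in a) ->
  #|[set f : {ffun T -> R} | [forall x in a, forall y, e x y ==> (f x == f y)]
       && [forall x, (x \notin a) ==> (f x == f (h x))]]|
  = #|R| ^ n_comp e a.
Proof.
move=> symE clA hA.
pose S := {x : T | roots e x && (x \in a)}.
pose k x := if x \in a then x else h x.
have kA x : k x \in a by rewrite /k; case: ifPn => // /hA.
have rP x : roots e (fingraph.root e (k x)) && (fingraph.root e (k x) \in a).
  by rewrite roots_root //= -(closed_connect clA (connect_root e (k x))).
pose F (g : {ffun S -> R}) : {ffun T -> R} :=
  [ffun x => g (exist _ (fingraph.root e (k x)) (rP x))].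
have injF : injective F.
  move=> g1 g2 /ffunP eqF; apply/ffunP=> s.
  have := eqF (sval s); rewrite !ffunE.
  suff -> : exist _ (fingraph.root e (k (sval s))) (rP (sval s)) = s by [].
  by apply: val_inj => /=; case: s => x /= /andP[/eqP rx ax]; rewrite /k ax.
have -> : n_comp e a = #|{: S}| by rewrite card_sig; apply: eq_card.
rewrite -card_ffun -(card_imset predT injF); apply: eq_card => f.
rewrite inE; apply/andP/imsetP => [[/forall_inP cf /forallP hf]|[g _ ->]].
  have ck x y : connect e x y -> x \in a -> f x = f y.
    move=> /connectP[p ep ->]; elim: p x ep => //= z p IH x /andP[exz ep] ax.
    rewrite (eqP (implyP (forallP (cf x ax) z) exz)).
    by apply: IH => //; rewrite -(clA _ _ exz).
  exists [ffun s : S => f (sval s)] => //; apply/ffunP => x.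
  rewrite !ffunE /= -(ck _ _ (connect_root e (k x))) //.
  by rewrite /k; case: ifPn => // ax; apply/eqP; apply: (implyP (hf x)).
split.
  apply/forall_inP => x ax; apply/forallP=> y; apply/implyP=> exy.
  rewrite !ffunE; apply/eqP; congr (g _); apply: val_inj => /=.
  have ay : y \in a by rewrite -(clA _ _ exy).
  by rewrite /k ax ay; apply/fingraph.rootP => //; apply: connect1.
apply/forallP=> x; apply/implyP=> ax; rewrite !ffunE; apply/eqP; congr (g _).
by apply: val_inj; rewrite /= /k (negPf ax) hA.
Qed.

(** Counting vectors suffices: a space of rank [r] over F_2 has [2 ^ r] elements. *)
Lemma mxrank_loc_const (T : finType) (e : rel T) m (U : 'M['F_2]_(m, #|T|)) :
    connect_sym e ->
    (forall v : 'rV_#|T|, reflect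
       (forall x y, e x y -> v 0%R (enum_rank x) = v 0%R (enum_rank y))
       (v <= U)%MS) ->
  \rank U = n_comp e T.
Proof.
move=> symE UP; apply: (@expnI #|'F_2|); first by rewrite card_Fp.
rewrite -card_rowg -(@card_loc_const T 'F_2 e T id symE) //.
pose F (v : 'rV['F_2]_#|T|) : {ffun T -> 'F_2} := [ffun x => v 0%R (enum_rank x)].
have injF : injective F.
  move=> u v /ffunP eqF; apply/rowP => i.
  by have := eqF (enum_val i); rewrite !ffunE enum_valK.
rewrite -(card_imset _ injF); apply: eq_card => f; rewrite inE.
apply/imsetP/andP => [[v]|[/forall_inP cf _]].
  rewrite mem_rowg => /UP cv ->; split; last by apply/forallP.
  apply/forall_inP=> x _; apply/forallP=> y; apply/implyP=> /cv.
  by rewrite !ffunE => ->.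
exists (\row_i f (enum_val i))%R; last by apply/ffunP=> x; rewrite !ffunE mxE enum_rankK.
rewrite mem_rowg; apply/UP => x y exy; rewrite !mxE !enum_rankK.
by apply/eqP; apply: (implyP (forallP (cf x isT) y)).
Qed.

(** Serves to evaluate a sum over darts edge by edge ([k = 2]) or crossing by crossing ([k = 4]). *)
Lemma big_orbits (R : Type) (idx : R) (op : Monoid.com_law idx) (I : finType)
    (f : I -> I) (P : pred I) (k : nat) (G : I -> R) :
    injective f -> (forall x, P (f x) = P x) -> (forall x, P x -> order f x = k) ->
  \big[op/idx]_(x | P x) G x
    = \big[op/idx]_(x | P x && froots f x) \big[op/idx]_(i < k) G (iter i f x).
Proof.
move=> injf Pf ordP; have symf := fconnect_sym injf.
have Piter i x : P (iter i f x) = P x by elim: i => //= i; rewrite Pf.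
have Pconn x y : fconnect f x y -> P x = P y by move/iter_findex <-; rewrite Piter.
rewrite (partition_big (froot f) (fun x => P x && froots f x)) /=; last first.
  by move=> x Px; rewrite roots_root // -(Pconn _ _ (connect_root _ x)) Px.
apply: eq_bigr => x /andP[Px /eqP rx].
transitivity (\big[op/idx]_(y <- orbit f x) G y).
  rewrite big_uniq ?orbit_uniq //; apply: eq_bigl => y.
  have -> : (froot f y == x) = fconnect f x y by rewrite symf -(root_connect symf) rx.
  by rewrite -fconnect_orbit; apply: andb_idl => xy; rewrite -(Pconn _ _ xy).
rewrite /orbit ordP //; elim: k x {Px rx ordP} => [|k IH] x.
  by rewrite big_nil big_ord0.
rewrite /= big_cons big_ord_recl IH; congr (op _ _).
by apply: eq_bigr => i _; rewrite -iterSr.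
Qed.

(** * In genus 0, every mod 2 cycle bounds a set of faces *)

Section PlanarBoundary.
Variables (D : finType) (al sg : D -> D).
Hypotheses (mapD : is_map al sg) (planD : planar_map al sg).
Local Open Scope ring_scope.

Let alK d : al (al d) = d. Proof. by case: mapD. Qed.
Let al_neq d : al d != d. Proof. by case: mapD => _ []. Qed.
Let injsg : injective sg. Proof. by case: mapD => _ []. Qed.
Let injal : injective al. Proof. exact: can_inj alK. Qed.

Definition shift_mx (p : D -> D) : 'M['F_2]_#|D| :=
  \matrix_(i, j) ((enum_val i == p (enum_val j))%:R - (i == j)%:R).

Lemma mul_shift_mx p (v : 'rV_#|D|) x :
  (v *m shift_mx p) 0 (enum_rank x) = v 0 (enum_rank (p x)) - v 0 (enum_rank x).
Proof.
rewrite mxE; under eq_bigr do rewrite mxE enum_rankK mulrBr.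
rewrite sumrB (bigD1 (enum_rank (p x))) //= enum_rankK eqxx mulr1 big1 ?addr0.
  rewrite (bigD1 (enum_rank x)) //= eqxx mulr1 big1 ?addr0 // => i /negPf ->.
  by rewrite mulr0.
move=> i ni; rewrite (_ : _ == _ = false) ?mulr0 //.
by apply: contraNF ni => /eqP <-; rewrite enum_valK.
Qed.

(** The row space consists of the functions on edges, vertices or faces when [p] is [al], [sg] or
    [sg \o al]. *)
Definition inv_mx p := kermx (shift_mx p).

Lemma inv_mxP p (v : 'rV_#|D|) :
  reflect (forall x, v 0 (enum_rank (p x)) = v 0 (enum_rank x)) (v <= inv_mx p)%MS.
Proof.
apply: (iffP sub_kermxP) => [v0 x|vp].
  by apply/eqP; rewrite -subr_eq0 -mul_shift_mx v0 mxE.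
by apply/rowP=> i; rewrite -(enum_valK i) mul_shift_mx vp subrr mxE.
Qed.

Lemma mxrank_inv p : injective p -> \rank (inv_mx p) = fcard p D.
Proof.
move=> injp; apply: mxrank_loc_const; first exact: fconnect_sym.
move=> v; apply: (iffP (inv_mxP p v)) => [vp x y /eqP <-|vp x] //.
by rewrite (vp x (p x)) //=.
Qed.

Lemma order_edge x : order al x = 2%N.
Proof.
have : fcycle al [:: x; al x] by rewrite /= alK !eqxx.
move=> /order_cycle -> //; last by rewrite inE eqxx.
by rewrite /= inE eq_sym al_neq.
Qed.

Lemma fcard_edges : (fcard al D * 2)%N = #|D|.
Proof. by apply: fcard_order_set => //; apply/subsetP=> x _; rewrite inE order_edge. Qed.

(** Invariance under both permutations means constancy on the components of the map. The parameter
    [p] covers both [sg] and [sg \o al]. *)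
Lemma mxrank_inv_al_cap (p : D -> D) :
    (forall v : 'rV['F_2]_#|D|, (v <= inv_mx al)%MS ->
       (v <= inv_mx p)%MS = (v <= inv_mx sg)%MS) ->
  \rank (inv_mx al :&: inv_mx p)%MS = map_components al sg.
Proof.
move=> pE; apply: mxrank_loc_const.
  apply: sym_connect_sym => x y; rewrite /map_conn (orbC (y == sg x)).
  by congr (_ || _); apply/eqP/eqP => ->; rewrite alK.
move=> v; rewrite sub_capmx; apply: (iffP andP) => [[va vp] x y|vc].
  move: vp; rewrite pE // => /inv_mxP vs; move/inv_mxP: va => va.
  by move=> /orP[/orP[]|] /eqP ->; rewrite ?vs ?va.
have va : (v <= inv_mx al)%MS.
  by apply/inv_mxP=> x; apply/esym/vc; rewrite /map_conn eqxx !orbT.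
split; first exact: va.
by rewrite (pE _ va); apply/inv_mxP=> x; apply/esym/vc; rewrite /map_conn eqxx.
Qed.

Let N0 (a : 'F_2) : a = (a != 0)%:R.
Proof. by apply/val_inj; case: a => [[|[|]]]. Qed.

Lemma natrF2_addb (a b : bool) : (a (+) b)%:R = a%:R + b%:R :> 'F_2.
Proof. by apply/val_inj; case: a b => [] []. Qed.

Lemma row_mul_tr m (U : 'M['F_2]_(m, #|D|)) (v : 'rV_#|D|) :
    (forall w : 'rV_#|D|, (w <= U)%MS ->
       \sum_x v 0 (enum_rank x) * w 0 (enum_rank x) = 0) ->
  v *m U^T = 0.
Proof.
move=> vU; apply/rowP=> j; rewrite !mxE.
rewrite (reindex (@enum_rank D)); last first.
  by exists enum_val => x _; rewrite ?enum_rankK ?enum_valK.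
rewrite -[RHS](vU (row j U) (row_sub j U)).
by apply: eq_bigr => x _; rewrite !mxE.
Qed.

Lemma sum_al_invariant (G : D -> 'F_2) : (forall x, G (al x) = G x) -> \sum_x G x = 0.
Proof.
move=> Ga; rewrite (@big_orbits _ _ _ _ al _ 2) //; last by move=> *; apply: order_edge.
rewrite big1 // => x _; rewrite big_ord_recr big_ord1 /= Ga.
by apply/val_inj; case: (G x) => [[|[|]]].
Qed.

(** Orthogonality to [inv_mx al] means taking equal values on both darts of each edge, and
    orthogonality to [inv_mx sg] means an even sum at each vertex. So [kermx ortho^T] is the space
    of mod 2 cycles. *)
Let ortho := col_mx (inv_mx al) (inv_mx sg).

(** Boundaries are cycles. The jump [f (al x) - f x] of a face function sums to zero against edge
    functions by reindexing along [al], and against vertex functions along [sg], because [al x] and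
    [sg x] lie on the same face. *)
Lemma face_boundary_orth :
  (inv_mx (sg \o al) *m shift_mx al <= kermx ortho^T)%MS.
Proof.
apply/sub_kermxP/row_matrixP => i; rewrite row0 2!row_mul.
have /inv_mxP := row_sub i (inv_mx (sg \o al)); set v := row i _ => vf.
rewrite tr_col_mx mul_mx_row; apply/eqP; rewrite row_mx_eq0; apply/andP.
split; apply/eqP/row_mul_tr => w /inv_mxP wp;
  under eq_bigr do rewrite mul_shift_mx mulrBl; rewrite sumrB.
  rewrite (reindex_inj injal) /=.
  by under eq_bigr do rewrite alK wp; rewrite subrr.
rewrite [X in _ - X](reindex_inj injsg) /=; apply/eqP; rewrite subr_eq0; apply/eqP.
by apply: eq_bigr => x _; rewrite wp; have := vf (al x); rewrite /= alK => ->.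
Qed.

(* Both spaces have dimension [E - V + C = F - C], by Euler's formula. *)
Lemma face_boundary_orth_eq :
  (inv_mx (sg \o al) *m shift_mx al == kermx ortho^T)%MS.
Proof.
have injf : injective (sg \o al) by apply: inj_comp.
rewrite -(mxrank_leqif_eq face_boundary_orth); apply/eqP.
(* The face functions without a jump across any edge are those constant on each component. *)
have capE : \rank (inv_mx (sg \o al) :&: kermx (shift_mx al)) = map_components al sg.
  rewrite capmxC; apply: mxrank_inv_al_cap => v /inv_mxP va.
  apply/inv_mxP/inv_mxP => vp x; last by rewrite /= vp va.
  by have := vp (al x); rewrite /= alK va.
have rF := mxrank_inv injf; have rA := mxrank_inv injal; have rS := mxrank_inv injsg.
have capAS : \rank (inv_mx al :&: inv_mx sg) = map_components al sg.
  by apply: mxrank_inv_al_cap => v _.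
have dimB : (\rank (inv_mx (sg \o al) *m shift_mx al) + map_components al sg
              = fcard (sg \o al) D)%N.
  exact: etrans (etrans (congr1 (addn _) (esym capE)) (mxrank_mul_ker _ _)) rF.
have dimO : (\rank ortho + map_components al sg = fcard al D + fcard sg D)%N.
  have rO : \rank ortho = \rank (inv_mx al + inv_mx sg)%MS by rewrite addsmxE.
  apply: etrans (congr2 addn rO (esym capAS)) _.
  exact: etrans (mxrank_sum_cap _ _) (congr2 addn rA rS).
have dimZ : \rank (kermx ortho^T) = (fcard al D * 2 - \rank ortho)%N.
  exact: etrans (mxrank_ker _) (congr2 subn (esym fcard_edges) (mxrank_tr _)).
have dimO_le : (\rank ortho <= fcard al D * 2)%N.
  exact: leq_trans (rank_leq_col _) (eq_leq (esym fcard_edges)).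
have edgeE : map_edges D = fcard al D by rewrite /map_edges -fcard_edges mulnK.
move: planD dimB dimO dimZ dimO_le; rewrite /planar_map /map_vertices /map_faces edgeE.
generalize (\rank (inv_mx (sg \o al) *m shift_mx al)) (\rank (kermx ortho^T)).
generalize (\rank ortho) (fcard al D) (fcard sg D) (fcard (sg \o al) D).
generalize (map_components al sg).
by move=> *; lia.
Qed.

(** Evenness of [s] at the vertices is tested against all vertex functions [g]. In the conclusion
    [f d] is the value on the face of [d]; [al d] and [sg d] both lie on the face across the
    edge. *)
Lemma boundary_of_cycle (s : D -> bool) :
    (forall d, s (al d) = s d) ->
    (forall g : D -> bool, (forall d, g (sg d) = g d) ->
       \big[addb/false]_d (g d && s d) = false) ->
  exists f : D -> bool, forall d, f (sg d) = f d (+) s d /\ f (al d) = f d (+) s d.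
Proof.
move=> sal ssg; pose v : 'rV['F_2]_#|D| := \row_i (s (enum_val i))%:R.
have : (v <= kermx ortho^T)%MS.
  apply/sub_kermxP; rewrite tr_col_mx mul_mx_row; apply/eqP.
  rewrite row_mx_eq0; apply/andP; split; apply/eqP/row_mul_tr => w /inv_mxP wp.
    by apply: sum_al_invariant => x; rewrite wp !mxE !enum_rankK sal.
  pose g x := w 0 (enum_rank x) != 0.
  transitivity ((\big[addb/false]_d (g d && s d))%:R : 'F_2); last first.
    by rewrite ssg // => d; rewrite /g wp.
  rewrite (big_morph (fun b : bool => b%:R : 'F_2) natrF2_addb (erefl _)).
  apply: eq_bigr => x _; rewrite mxE enum_rankK [w _ _]N0 -/(g x).
  by case: (g x) (s x) => [] []; rewrite ?mulr1 ?mulr0.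
rewrite -(eqmxP face_boundary_orth_eq) => /submxP[u uE].
have vE x : (s x)%:R = (v 0 (enum_rank x)) by rewrite mxE enum_rankK.
move: vE; rewrite uE mulmxA; set w := u *m _.
have /inv_mxP wf : (w <= inv_mx (sg \o al))%MS by apply: submxMl.
move=> sE; pose f x := w 0 (enum_rank x) != 0.
have fal d : f (al d) = f d (+) s d.
  have -> : f (al d) = ((s d)%:R + w 0 (enum_rank d) != 0).
    by rewrite sE mul_shift_mx subrK.
  by rewrite /f; move: (w _ _) => a; rewrite [a]N0; case: (a != 0) (s d) => [] [].
exists f => d; split=> //; rewrite -fal.
by rewrite /f; have := wf (al d); rewrite /= alK => ->.
Qed.
End PlanarBoundary.

(** * Factorisation of state sums *)

Lemma sum_powerset_prod (R : comPzRingType) (T : finType) (X : {set T}) (F G : T -> R) :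
  (\sum_(B in powerset X) \prod_(t in X) (if t \in B then F t else G t)
    = \prod_(t in X) (F t + G t))%R.
Proof.
(* Outside [X] the factor becomes [0 + 1], so subsets not contained in [X] contribute zero. *)
pose F' t := (if t \in X then F t else 0)%R; pose G' t := (if t \in X then G t else 1)%R.
transitivity (\prod_t (F' t + G' t))%R; last first.
  rewrite [RHS]big_mkcond /=; apply: eq_bigr => t _; rewrite /F' /G'.
  by case: ifP; rewrite ?add0r.
rewrite bigA_distr [LHS]big_mkcond /=; apply: eq_bigr => B _; rewrite powersetE.
case: ifPn => [sBX|/subsetPn[t tB tX]]; last first.
  by rewrite (bigD1 t) //= tB /F' (negPf tX) mul0r.
rewrite [LHS]big_mkcond /=; apply: eq_bigr => t _; rewrite /F' /G'.
by case: ifPn => // tX; rewrite (contraNF (subsetP sBX t) tX).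
Qed.

(** Weights and condition are both products over [X]. The bracket uses [-1, 1] on matching edges and
    [2, -1] on crossings; the colour bracket uses [1, 1] on matching edges. *)
Lemma sum_powerset_forall (R : comPzRingType) (T : finType) (X : {set T}) (x y : R)
    (b c : T -> bool) :
  (\sum_(B in powerset X) x ^+ #|B| * y ^+ (#|X| - #|B|)
      * [forall t in X, if t \in B then b t else c t]%:R
    = \prod_(t in X) (x * (b t)%:R + y * (c t)%:R))%R.
Proof.
rewrite -sum_powerset_prod; apply: eq_bigr => B; rewrite powersetE => sBX.
have powE : (x ^+ #|B| * y ^+ (#|X| - #|B|) =
             \prod_(t in X) (if t \in B then x else y))%R.
  rewrite (big_setID B) /= (setIidPr sBX) -cardsDS // -!prodr_const.
  congr (_ * _)%R; first by apply: eq_bigr => t ->.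
  by apply: eq_bigr => t; rewrite inE => /andP[/negPf ->].
have andE : ([forall t in X, if t \in B then b t else c t]%:R =
             \prod_(t in X) (if t \in B then b t else c t)%:R :> R)%R.
  rewrite -big_andE (big_morph (fun b : bool => b%:R : R)%R (id1 := 1%R) (op1 := *%R)) //.
  by move=> [] []; rewrite ?mulr1 ?mulr0.
rewrite powE andE -big_split; apply: eq_bigr => t _ /=.
by case: ifP.
Qed.

(** * Local structure of the diagram and parity of bichromatic crossings *)

Section Parity.
Variables (D : finType) (al sg : D -> D) (mt : D -> bool).
Hypothesis diag : trivalent_pm_diagram al sg mt.

Let mapD : is_map al sg. Proof. by case: diag. Qed.
Let alK d : al (al d) = d. Proof. by case: mapD. Qed.
Let injsg : injective sg. Proof. by case: mapD => _ []. Qed.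
Let injal : injective al. Proof. exact: can_inj alK. Qed.
Let mt_al d : mt (al d) = mt d. Proof. by case: diag. Qed.

Lemma order_sg d : order sg (sg d) = order sg d.
Proof. by apply: eq_card => y; rewrite -!topredE /= -(same_fconnect1 injsg). Qed.

Lemma mt_order3 d : mt d -> order sg d = 3.
Proof.
case: diag => _ _ ord _ [_ mt4 _] md; case: (ord d) => // /mt4.
by rewrite md.
Qed.

Lemma mtF_order4 d : order sg d = 4 -> mt d = false.
Proof. by case: diag => _ _ _ _ [_ + _]; apply. Qed.

Lemma sg3 d : order sg d = 3 -> sg (sg (sg d)) = d.
Proof. by move=> o; have := iter_order injsg d; rewrite o. Qed.

Lemma mt_vertex d : order sg d = 3 -> mt d + mt (sg d) + mt (sg (sg d)) = 1.
Proof. by case: diag => _ _ _ _ [+ _ _]; apply. Qed.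

Lemma order34 d : order sg d != 4 -> order sg d = 3.
Proof. by case: diag => _ _ ord _ _; case: (ord d) => // ->. Qed.

Lemma mt_sg m : mt m -> mt (sg m) = false /\ mt (sg (sg m)) = false.
Proof.
move=> mm; have := mt_vertex (mt_order3 mm); rewrite mm.
by case: (mt (sg m)); case: (mt (sg (sg m))).
Qed.

Lemma mt_sg3 d : mt (sg (sg (sg d))) = mt d.
Proof.
have [o|/order34 o] := eqVneq (order sg d) 4; last by rewrite sg3.
by rewrite !mtF_order4 ?order_sg.
Qed.

(** Away from the crossings, a non-matching dart is the first or second successor of the unique
    matching dart at its vertex. *)
Lemma big_nonmatching (R : Type) (idx : R) (op : Monoid.com_law idx) (G : D -> R) :
  \big[op/idx]_(x | ~~ mt x) G x =
  op (\big[op/idx]_(m | mt m) op (G (sg m)) (G (sg (sg m))))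
     (\big[op/idx]_(x | order sg x == 4) G x).
Proof.
rewrite (bigID (fun x => order sg x == 4)) /= Monoid.mulmC; congr (op _ _); last first.
  by apply: eq_bigl => x; apply: andb_idl => /eqP/mtF_order4 ->.
rewrite big_split /= (bigID (fun x => mt (sg x))) /= Monoid.mulmC; congr (op _ _).
  rewrite (reindex_inj injsg) /=; apply: eq_bigl => x; rewrite order_sg.
  have [o|/order34 o] := eqVneq (order sg x) 4; first by rewrite (mtF_order4 o) andbF.
  have := mt_vertex o; case: (mt x); case: (mt (sg x)); case: (mt (sg (sg x))) => //.
rewrite (reindex_inj injsg) (reindex_inj injsg) /=; apply: eq_bigl => x.
rewrite mt_sg3 !order_sg.
have [o|/order34 o] := eqVneq (order sg x) 4; first by rewrite (mtF_order4 o) andbF.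
have := mt_vertex o; case: (mt x); case: (mt (sg x)); case: (mt (sg (sg x))) => //.
Qed.

Lemma big_crossings (R : Type) (idx : R) (op : Monoid.com_law idx) (G : D -> R) :
  \big[op/idx]_(x | order sg x == 4) G x =
  \big[op/idx]_(x in crossings sg)
     op (G x) (op (G (sg x)) (op (G (sg (sg x))) (G (sg (sg (sg x)))))).
Proof.
rewrite (@big_orbits _ _ _ _ sg _ 4) //; first last.
- by move=> x /eqP.
- by move=> x; rewrite order_sg.
apply: eq_big => [x|x _]; first by rewrite inE.
by rewrite 4!big_ord_recl big_ord0 /= Monoid.mulm1.
Qed.

Lemma big_matching (R : Type) (idx : R) (op : Monoid.com_law idx) (G : D -> R) :
  \big[op/idx]_(m | mt m) G m =
  \big[op/idx]_(m in matching_edges al mt) op (G m) (G (al m)).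
Proof.
rewrite (@big_orbits _ _ _ _ al _ 2) //; last by move=> x _; exact: order_edge mapD x.
apply: eq_big => [x|x _]; first by rewrite inE.
by rewrite 2!big_ord_recl big_ord0 /= Monoid.mulm1.
Qed.

Variables (n : nat) (col : D -> 'I_n).

(** [fits0] and [fits1] express that [col] is constant along both arcs of the 0-smoothing and of the
    1-smoothing. *)
Definition fits0 m :=
  (col (sg m) == col (sg (sg (al m)))) && (col (sg (sg m)) == col (sg (al m))).
Definition fits1 m :=
  (col (sg m) == col (sg (al m))) && (col (sg (sg m)) == col (sg (sg (al m)))).

Hypothesis col_al : forall x, ~~ mt x -> col (al x) = col x.
Hypothesis col_sg2 : forall x, order sg x = 4 -> col (sg (sg x)) = col x.

Section Proper.
Hypothesis col_neq : forall m, mt m -> col (sg m) != col (sg (sg m)).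
Hypothesis col_fits : forall m, mt m -> fits0 m || fits1 m.

(* A matching edge carries both colours of its end points, hence the xor. *)
Let cyc (t : nat) x :=
  if mt x then (col (sg x) < t) (+) (col (sg (sg x)) < t) else col x < t.

(** Under either smoothing both ends of a matching edge carry the same two colours. *)
Let cyc_al t x : cyc t (al x) = cyc t x.
Proof.
rewrite /cyc mt_al; case: ifPn => [mx|/col_al -> //].
by case/orP: (col_fits mx) => /andP[/eqP -> /eqP ->]; rewrite // addbC.
Qed.

(** At a crossing each strand counts twice; at a vertex of the graph the matching dart cancels its
    two neighbours. *)
Let cyc_even t (g : D -> bool) :
  (forall d, g (sg d) = g d) -> \big[addb/false]_d (g d && cyc t d) = false.
Proof.
move=> gs; rewrite (bigID mt) /= [X in _ (+) X]big_nonmatching addbA.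
rewrite -big_split big_crossings /=.
rewrite !big1 //= => [x|m mm].
  rewrite inE => /andP[/eqP o _].
  rewrite /cyc !mtF_order4 ?order_sg // !gs !(col_sg2 o) (col_sg2 (etrans (order_sg x) o)).
  by case: (g x) (_ < _) (_ < _) => [] [] [].
have [m1 m2] := mt_sg mm; rewrite /cyc mm m1 m2 !gs.
by case: (g m) (_ < _) (_ < _) => [] [] [].
Qed.

Lemma bichromatic_crossings_even :
  \big[addb/false]_(x in crossings sg) (col x != col (sg x)) (+)
  \big[addb/false]_(m in matching_edges al mt) fits1 m = false.
Proof.
have planD : planar_map al sg by case: diag.
have [f fP] : exists f : 'I_n -> D -> bool, forall t, forall d,
    f t (sg d) = f t d (+) cyc t d /\ f t (al d) = f t d (+) cyc t d.
  apply: (@fin_all_exists _ (fun=> D -> bool) (fun (t : 'I_n) g => forall d,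
    g (sg d) = g d (+) cyc t d /\ g (al d) = g d (+) cyc t d)) => t.
  apply: (boundary_of_cycle mapD planD) => //.
  exact: cyc_even.
have fsg t d : f t (sg d) = f t d (+) cyc t d by case: (fP t d).
have fal t d : f t (al d) = f t d (+) cyc t d by case: (fP t d).
(* An edge of colour [c] is not in the cycle of colours strictly below [c], so [f c] agrees on its
   two darts. *)
have : \big[addb/false]_(x | ~~ mt x) f (col x) x = false.
  rewrite (@big_orbits _ _ _ _ al _ 2) //; last 2 first.
  - by move=> x; rewrite mt_al.
  - by move=> x _; exact: order_edge mapD x.
  rewrite big1 // => x /andP[mx _]; rewrite 2!big_ord_recl big_ord0 /=.
  by rewrite col_al // fal /cyc (negPf mx) ltnn !addbF addbb.
rewrite big_nonmatching big_crossings big_matching /= addbC => total.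
rewrite -[RHS]total.
congr (_ (+) _); apply: eq_bigr => x; rewrite inE => /andP[].
  (* If the strands have colours [a] and [b], the four darts leave [(b < a) (+) (a < b)], that is
     [a != b]. *)
  move=> /eqP o _; have o1 := etrans (order_sg x) o.
  rewrite (col_sg2 o) (col_sg2 o1) !fsg /cyc !mtF_order4 ?order_sg //.
  rewrite (col_sg2 o) -(inj_eq val_inj) !ltnn.
  by case: ltngtP; case: (f _ _) (f _ _) => [] [].
(* With colours [a], [b] at one end and [c], [d] at the other, a permutation of [a], [b], the values
   of [f] reduce to [1 (+) (b < a) (+) (d < c)]. This is 1 when [c = a] and [d = b], the case
   [fits1], and 0 when the two are exchanged. *)
move=> mm _; have mam : mt (al x) by rewrite mt_al.
have [m1 _] := mt_sg mm; have [a1 _] := mt_sg mam.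
have := col_neq mm; have := col_fits mm.
rewrite !fsg !fal !cyc_al /cyc mm m1 a1 /fits0 /fits1.
move: (col (sg x)) (col (sg (sg x))) (col (sg (al x))) (col (sg (sg (al x)))).
move=> a b c d; rewrite -!(inj_eq val_inj) /=.
move=> /orP[]/andP[/eqP/val_inj <- /eqP/val_inj <-];
  rewrite ?eqxx ?ltnn /=; case: (f a x); case: (f b x); case: ltngtP => //=.
Qed.
End Proper.

(** * The total weight of one colouring *)

Lemma fits0_al m : fits0 (al m) = fits0 m.
Proof. by rewrite /fits0 alK andbC; congr (_ && _); rewrite eq_sym. Qed.

Lemma fits1_al m : fits1 (al m) = fits1 m.
Proof. by rewrite /fits1 alK; congr (_ && _); rewrite eq_sym. Qed.

(** Products over matching edges see one dart per edge; this passes from any matching dart to that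
    representative. *)
Lemma matching_edge_root m : mt m ->
  [/\ froot al m \in matching_edges al mt, fits0 (froot al m) = fits0 m
     & fits1 (froot al m) = fits1 m].
Proof.
move=> mm; have symal := fconnect_sym injal.
have inv (T' : eqType) (k : D -> T') : (forall x, k (al x) = k x) -> k (froot al m) = k m.
  move=> kal; apply/esym/(@fconnect_invariant _ al _ k); last exact: connect_root.
  by move=> x; rewrite /= kal eqxx.
by split; [rewrite inE roots_root // inv // mm | apply: inv fits0_al | apply: inv fits1_al].
Qed.

(** If the two colours at an end of some edge coincide, its smoothings fit both or neither and its
    factor is 0. If some edge fits neither smoothing, both sides vanish. Otherwise exactly one
    smoothing fits at each edge, all factors on the left are signs, and parity makes their product
    1. *)
Lemma weight_matching (proper : bool) :
    (proper <-> forall m, mt m -> col (sg m) != col (sg (sg m))) ->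
  (\prod_(m in matching_edges al mt) (-1 * (fits1 m)%:R + 1 * (fits0 m)%:R)
    * \prod_(x in crossings sg) (2%:Z * (col x == col (sg x))%:R + -1 * true%:R)
   = proper%:R * \prod_(m in matching_edges al mt) (1 * (fits1 m)%:R + 1 * (fits0 m)%:R))%R.
Proof.
have zero (F : D -> int) m : m \in matching_edges al mt -> F m = 0%R ->
    (\prod_(m in matching_edges al mt) F m = 0)%R.
  by move=> mM Fm; rewrite (bigD1 m) //= Fm mul0r.
case: proper => -[pP Pp]; last first.
  have [m mm abm] : exists2 m, mt m & col (sg m) == col (sg (sg m)).
    have [/existsP[m /andP[mm ab]]|no] :=
      boolP [exists m, mt m && (col (sg m) == col (sg (sg m)))].
      by exists m.
    suff : false by [].
    apply: Pp => m mm; apply: contra no => ab.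
    by apply/existsP; exists m; rewrite mm.
  have [mM m0 m1] := matching_edge_root mm; rewrite mul0r (zero _ _ mM) ?mul0r //.
  rewrite m0 m1 /fits0 /fits1 (eqP abm) andbC mul1r mulN1r; apply/eqP.
  by rewrite addrC subr_eq0.
have neq := pP isT; rewrite mul1r.
have [/forall_inP fit|] :=
  boolP [forall m in matching_edges al mt, fits0 m || fits1 m]; last first.
  rewrite negb_forall_in => /exists_inP[m mM].
  rewrite negb_or => /andP[/negPf m0 /negPf m1].
  by rewrite !(zero _ _ mM) ?mul0r // m0 m1.
have fitm m : mt m -> fits0 m || fits1 m.
  by move=> /matching_edge_root[/fit + <- <-].
have even := bichromatic_crossings_even neq fitm.
have excl m : m \in matching_edges al mt -> fits0 m = ~~ fits1 m.
  rewrite inE => /andP[mm _]; have := fitm _ mm; have := neq _ mm.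
  rewrite /fits0 /fits1; move: (col _) (col _) (col _) (col _) => a b c d /negPf ab.
  by case/orP=> /andP[/eqP <- /eqP <-]; rewrite !eqxx ab.
transitivity (1%R : int); last first.
  by rewrite big1 // => m /excl ->; case: fits1.
pose sgn (b : bool) : int := ((-1) ^+ b)%R.
rewrite (eq_bigr (fun m => sgn (fits1 m))); last by move=> m /excl ->; case: fits1.
rewrite [X in (_ * X)%R](eq_bigr (fun x => sgn (col x != col (sg x)))); last first.
  by move=> x _; case: eqP.
have sgnM : {morph sgn : a b / a (+) b >-> (a * b)%R} by move=> a b; apply: signr_addb.
by rewrite -!(big_morph sgn sgnM (erefl _ : sgn false = 1%R)) -sgnM addbC even.
Qed.
End Parity.

(** * Expansion of both brackets over colourings *)

Section Expansion.
Variables (D : finType) (al sg : D -> D) (mt : D -> bool) (n : nat).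
Hypothesis diag : trivalent_pm_diagram al sg mt.
Implicit Types (col : {ffun D -> 'I_n}) (alpha beta : {set D}).

Let mapD : is_map al sg. Proof. by case: diag. Qed.
Let injsg : injective sg. Proof. by case: mapD => _ []. Qed.
Let mt_al d : mt (al d) = mt d. Proof. by case: diag. Qed.

Definition state_const alpha beta col :=
  [forall x, forall y, state_rel al sg mt alpha beta x y ==> (col x == col y)].

(* The normalisation of the unused values on matching darts in [state_colorings]. *)
Definition matching_copy col := [forall m, mt m ==> (col m == col (sg m))].

(** The part of [state_const] common to all states. *)
Definition strand_const col :=
  [forall x, (~~ mt x ==> (col (al x) == col x)) &&
             ((order sg x == 4) ==> (col (sg (sg x)) == col x))].

(** One colour is chosen per component; the successor copied by a matching dart is always
    non-matching. *)
Lemma expn_ncomp_state alpha beta :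
  n ^ ncomp_state al sg mt alpha beta
  = #|[set col | state_const alpha beta col && matching_copy col]|.
Proof.
have symE : symmetric (state_rel al sg mt alpha beta).
  by move=> x y; rewrite /state_rel orbC.
have relN x y : state_rel al sg mt alpha beta x y -> ~~ mt x /\ ~~ mt y.
  by case/orP=> /andP[/andP[]].
have cl : closed (state_rel al sg mt alpha beta) [pred d | ~~ mt d].
  by move=> x y /relN[mx my]; rewrite !inE mx my.
have hA x : x \notin [pred d | ~~ mt d] -> sg x \in [pred d | ~~ mt d].
  by rewrite !inE negbK => /(mt_sg diag)[-> _].
rewrite -[n in LHS]card_ord -(card_loc_const 'I_n (sym_connect_sym symE) cl hA).
apply: eq_card => col; rewrite !inE; congr (_ && _).
  apply/forall_inP/forallP => [cc x|cc x _]; last exact: cc.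
  apply/forallP=> y; apply/implyP=> xy; have [mx _] := relN _ _ xy.
  exact: (implyP (forallP (cc x mx) y) xy).
by apply: eq_forallb => x; rewrite !inE negbK.
Qed.

(** Separating [alpha] from [beta] lets the two state sums factor for a fixed colouring. *)
Lemma state_constE alpha beta col : beta \subset crossings sg ->
  state_const alpha beta col =
  [&& strand_const col,
      [forall x in crossings sg, if x \in beta then col x == col (sg x) else true]
    & [forall m in matching_edges al mt,
         if m \in alpha then fits1 al sg col m else fits0 al sg col m]].
Proof.
move=> sbX; apply/forallP/and3P => [cc|[/forallP sc /forall_inP bc /forall_inP ac] x].
  have {}cc x y : state_rel0 al sg mt alpha beta x y -> col x = col y.
    move=> xy; apply/eqP/(implyP (forallP (cc x) y)); by rewrite /state_rel xy.
  split.
  - apply/forallP=> x; apply/andP; split; [apply/implyP=> mx | apply/implyP=> /eqP o].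
      by apply/eqP/esym/cc; rewrite /state_rel0 mt_al mx eqxx.
    apply/eqP/esym/cc; rewrite /state_rel0 !(mtF_order4 diag) ?(order_sg diag) //.
    by rewrite !eqxx o !orbT.
  - apply/forall_inP=> x; rewrite inE => /andP[/eqP o /eqP rx]; case: ifP => // xb.
    apply/eqP/cc; rewrite /state_rel0 !(mtF_order4 diag) ?(order_sg diag) //.
    by rewrite !eqxx o rx xb !orbT.
  - apply/forall_inP=> m; rewrite inE => /andP[mm /eqP rm].
    have [m1 m2] := mt_sg diag mm; have [a1 a2] := mt_sg diag (etrans (mt_al m) mm).
    case: ifP => mal; apply/andP; split; apply/eqP/cc; rewrite /state_rel0 ?m1 ?m2 ?a1 ?a2 /=;
      apply/or4P/Or44/existsP; exists m; rewrite /smooth_rel mm rm mal !eqxx ?orbT //.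
have {}sc1 z : ~~ mt z -> col (al z) = col z.
  by move=> mz; case/andP: (sc z) => /implyP/(_ mz)/eqP.
have {}sc2 z : order sg z = 4 -> col (sg (sg z)) = col z.
  by move=> o; case/andP: (sc z) => _ /implyP; rewrite o => /(_ isT)/eqP.
suff gen z w : state_rel0 al sg mt alpha beta z w -> col z = col w.
  by apply/forallP=> y; apply/implyP=> /orP[/gen ->|/gen ->].
case/andP=> /andP[mz mw] /or4P[/eqP ->|/andP[/eqP o /eqP ->]||/existsP[m]].
- by rewrite sc1.
- by rewrite sc2.
(* The node condition is tested only at the root of the crossing, while gluing relates every dart
   there to its successor. Equality propagates around because opposite darts agree. *)
- case/andP=> /andP[/eqP o rb] /eqP ->; have symsg := fconnect_sym injsg.
  have rX := subsetP sbX _ rb; have := bc _ rX; rewrite rb => /eqP cr.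
  have ro : order sg (froot sg z) = 4 by move: rX; rewrite inE => /andP[/eqP].
  have : fconnect sg (froot sg z) z by rewrite symsg connect_root.
  move/iter_findex <-; move: (findex _ _ _) => i.
  suff [] : col (iter i sg (froot sg z)) = col (sg (iter i sg (froot sg z)))
     /\ order sg (iter i sg (froot sg z)) = 4 by [].
  elim: i => [|i [IH oi]] //=; split; last by rewrite (order_sg diag).
  by rewrite (sc2 _ oi) IH.
case/andP=> mm; have [rM r0 r1] := matching_edge_root diag col mm.
have := ac _ rM; rewrite r0 r1 /fits0 /fits1.
by case: ifP => _ /andP[/eqP e1 /eqP e2] /orP[]/andP[/eqP -> /eqP ->].
Qed.

Lemma pk_bracket_color_bracket :
  pk_bracket al sg mt n = color_bracket al sg mt n.
Proof.
have powE alpha beta : (n%:Z ^+ ncomp_state al sg mt alpha beta =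
    \sum_col (state_const alpha beta col && matching_copy col)%:R)%R.
  rewrite -[Posz n]natz -natrX expn_ncomp_state -sum1_card natr_sum big_mkcond /=.
  by apply: eq_bigr => col _; rewrite inE; case: ifP.
pose A alpha col := [forall m in matching_edges al mt,
  if m \in alpha then fits1 al sg col m else fits0 al sg col m].
pose B beta col := [forall x in crossings sg,
  if x \in beta then col x == col (sg x) else true].
pose S col := strand_const col && matching_copy col.
pose proper col := [forall m, mt m ==> (col (sg m) != col (sg (sg m)))].
transitivity (\sum_col (S col)%:R *
   (\prod_(m in matching_edges al mt)
       (-1 * (fits1 al sg col m)%:R + 1 * (fits0 al sg col m)%:R)
    * \prod_(x in crossings sg) (2%:Z * (col x == col (sg x))%:R + -1 * true%:R)))%R.
  rewrite /pk_bracket.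
  (* The trivial power of 1 gives the sum over [alpha] the shape required by
     [sum_powerset_forall]. *)
  transitivity (\sum_(alpha in powerset (matching_edges al mt))
    \sum_(beta in powerset (crossings sg)) \sum_col (S col)%:R *
     (((-1) ^+ #|alpha| * 1 ^+ (#|matching_edges al mt| - #|alpha|) * (A alpha col)%:R) *
     (2%:Z ^+ #|beta| * (-1) ^+ (#|crossings sg| - #|beta|) * (B beta col)%:R)))%R.
    apply: eq_bigr => alpha _; apply: eq_bigr => beta; rewrite powersetE => sb.
    rewrite powE mulr_sumr.
    apply: eq_bigr => col _; rewrite state_constE // -/(A alpha col) -/(B beta col) /S.
    rewrite expr1n mulr1; case: (strand_const _); case: (matching_copy _);
    case: (A _ _); case: (B _ _); rewrite /= ?mulr0 ?mul0r ?mulr1 ?mul1r //.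
    by rewrite mulrA.
  under eq_bigr do rewrite exchange_big /=.
  rewrite exchange_big /=; apply: eq_bigr => col _.
  under eq_bigr do rewrite -mulr_sumr -mulr_sumr.
  by rewrite -mulr_sumr -mulr_suml !sum_powerset_forall.
transitivity (\sum_col (S col)%:R * ((proper col)%:R *
   \prod_(m in matching_edges al mt)
       (1 * (fits1 al sg col m)%:R + 1 * (fits0 al sg col m)%:R)) : int)%R.
  apply: eq_bigr => col _; rewrite /S.
  have [/forallP sc|] := boolP (strand_const col); last by rewrite !mul0r.
  congr (_ * _)%R; apply: (weight_matching diag).
  - by move=> z mz; case/andP: (sc z) => /implyP/(_ mz)/eqP.
  - by move=> z o; case/andP: (sc z) => _ /implyP; rewrite o => /(_ isT)/eqP.
  - split=> [/forallP p m mm|p]; first exact: (implyP (p m)).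
    by apply/forallP=> m; apply/implyP/p.
(* The product is expanded back into a sum over [alpha], now with all weights 1. *)
under eq_bigr do rewrite -sum_powerset_forall mulr_sumr mulr_sumr.
rewrite exchange_big /=; apply: eq_bigr => alpha _.
rewrite -[RHS]natz -[X in _ = X%:R%R]sum1_card natr_sum [RHS]big_mkcond /=.
apply: eq_bigr => col _; rewrite inE -/(state_const alpha set0 col) -/(A alpha col).
rewrite state_constE ?sub0set // -/(A alpha col).
have -> : [forall m, mt m ==> (col m == col (sg m)) && (col (sg m) != col (sg (sg m)))]
    = matching_copy col && proper col.
  apply/forallP/andP => [p|[/forallP p1 /forallP p2] m].
    by split; apply/forallP=> m; apply/implyP=> mm; case/andP: (implyP (p m) mm).
  by apply/implyP=> mm; rewrite (implyP (p1 m) mm) (implyP (p2 m) mm).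
have -> : [forall x in crossings sg, if x \in set0 then col x == col (sg x) else true].
  by apply/forall_inP=> x _; rewrite inE.
rewrite !expr1n !mul1r /S; case: (strand_const _); case: (matching_copy _);
    case: (A _ _); case: (proper _); by rewrite /= ?mulr0 ?mul0r ?mulr1 ?mul1r.
Qed.
End Expansion.

Theorem theorem4p10 (D : finType) (al sg : D -> D) (mt : D -> bool) (n : nat) :
  trivalent_pm_diagram al sg mt -> (0 < n)%N ->
  pk_bracket al sg mt n = color_bracket al sg mt n.
Proof. by move=> diag _; apply: pk_bracket_color_bracket. Qed.
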